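(* Let $(p_1,p_2)\in\mathbb{C}^{\times}\times\mathbb{C}^{\times}$, $\boldsymbol{\lambda}=(\lambda_1,\lambda_2)\in\mathbb{C}^{\times}\times\mathbb{C}^{\times}$, $\alpha\in\mathbb{C}$ and $b_{\mathbf 0}\in\mathbb{C}^{\times}$. Then $\Omega(\boldsymbol{\lambda},\alpha,b_{\mathbf 0})$ is a simple $L(p_1,p_2)$-module and a simple $\widetilde{L}(p_1,p_2)$-module.
   Context: $\mathbb{C}^{\times}=\mathbb{C}\setminus\{0\}$. For fixed $\mathbf p=(p_1,p_2)\in\mathbb{C}^2$, the generalized (centerless) Heisenberg-Virasoro algebra of rank two $L(p_1,p_2)$ is the complex Lie algebra spanned by $t^{\mathbf m},E(\mathbf m)$, $\mathbf m=(m_1,m_2)\in\mathbb{Z}^2$, with relations $[t^{\mathbf m},t^{\mathbf n}]=0$, $[t^{\mathbf m},E(\mathbf n)]=-|\mathbf m+\mathbf p,\mathbf n+\mathbf p|\,t^{\mathbf m+\mathbf n}$, $[E(\mathbf m),E(\mathbf n)]=-|\mathbf m+\mathbf p,\mathbf n+\mathbf p|\,E(\mathbf m+\mathbf n)$, where $|\mathbf m+\mathbf p,\mathbf n+\mathbf p|=(m_1+p_1)(n_2+p_2)-(m_2+p_2)(n_1+p_1)$. The Lie algebra $\widetilde{L}(p_1,p_2)$ is obtained from $L(p_1,p_2)$ by adjoining degree derivations $\partial_1,\partial_2$ with $[\partial_i,E(\mathbf m)]=m_iE(\mathbf m)$, $[\partial_i,t^{\mathbf m}]=(m_i+p_i)t^{\mathbf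 m}$ ($i=1,2$), $[\partial_1,\partial_2]=0$. For $\boldsymbol{\lambda}\in\mathbb{C}^{\times}\times\mathbb{C}^{\times}$, $\alpha\in\mathbb{C}$, $b_{\mathbf 0}\in\mathbb{C}^{\times}$, the $\widetilde L(p_1,p_2)$-module $\Omega(\boldsymbol{\lambda},\alpha,b_{\mathbf 0})$ is the polynomial space $\mathbb{C}[\partial_1,\partial_2]$ on which $\partial_1,\partial_2$ act by multiplication and, for $f\in\mathbb{C}[\partial_1,\partial_2]$, $E(\mathbf m)f(\partial_1,\partial_2)=\lambda_1^{m_1}\lambda_2^{m_2}[(m_2+p_2)(\partial_1+p_1\alpha)-(m_1+p_1)(\partial_2+p_2\alpha)]f(\partial_1-m_1,\partial_2-m_2)$, $t^{\mathbf m}f(\partial_1,\partial_2)=\lambda_1^{m_1}\lambda_2^{m_2}b_{\mathbf 0}f(\partial_1-m_1-p_1,\partial_2-m_2-p_2)$. It is regarded as an $L(p_1,p_2)$-module by restriction. *)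

(* Defs.v *)
From HB Require Import structures.
From mathcomp Require Import all_boot all_order all_algebra.
From mathcomp Require Import reals complex.
From mathcomp Require Import mpoly freeg.
From mathcomp Require Import ring.

Set Implicit Arguments.
Unset Strict Implicit.
Unset Printing Implicit Defensive.

Import GRing.Theory.
Local Open Scope ring_scope.

HB.mixin Record isLieAlgebra (K : fieldType) L of GRing.Lmodule K L := {
  lie : L -> L -> L;
  lie_linearl : forall y, linear (fun x => lie x y);
  lie_linearr : forall x, linear (lie x);
  liexx : forall x, lie x x = 0;
  lie_jacobi : forall x y z,
    lie x (lie y z) + lie y (lie z x) + lie z (lie x y) = 0 }.

#[short(type="lieAlgType")]
HB.structure Definition LieAlgebra (K : fieldType) :=
  {L of isLieAlgebra K L & GRing.Lmodule K L}.

Record lieModule (K : fieldType) (L : lieAlgType K) := LieModule {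
  lieModule_sort :> lmodType K;
  lact : L -> lieModule_sort -> lieModule_sort;
  lact_linearl : forall v, linear (fun x => lact x v);
  lact_linearr : forall x, linear (lact x);
  lact_lie : forall x y v,
    lact (lie x y) v = lact x (lact y v) - lact y (lact x v) }.

Definition submodule (K : fieldType) (L : lieAlgType K) (M : lieModule L)
    (S : M -> Prop) : Prop :=
  [/\ S 0,
      forall (c : K) (u v : M), S u -> S v -> S (c *: u + v) &
      forall (x : L) (v : M), S v -> S (lact x v)].

Definition simple_module (K : fieldType) (L : lieAlgType K) (M : lieModule L) :
    Prop :=
  (exists v : M, v <> 0) /\
  forall S : M -> Prop, submodule S ->
    (forall v, S v -> v = 0) \/ (forall v, S v).

Record lieHom (K : fieldType) (L L' : lieAlgType K) := LieHom {
  lieHom_fun :> L -> L';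
  lieHom_linear : linear lieHom_fun;
  lieHom_lie : forall x y, lieHom_fun (lie x y) = lie (lieHom_fun x) (lieHom_fun y) }.

Section Restriction.
Context (K : fieldType) (L L' : lieAlgType K) (phi : lieHom L L').
Context (M : lieModule L').

Let ract (x : L) (v : M) : M := lact (phi x) v.

Fact ract_linearl v : linear (fun x => ract x v).
Proof. by move=> c x y; rewrite /ract lieHom_linear lact_linearl. Qed.

Fact ract_linearr x : linear (ract x).
Proof. exact: lact_linearr. Qed.

Fact ract_lie x y v : ract (lie x y) v = ract x (ract y v) - ract y (ract x v).
Proof. by rewrite /ract lieHom_lie lact_lie. Qed.

Definition lieModule_res : lieModule L := LieModule ract_linearl ract_linearr ract_lie.

End Restriction.

Section Extension.
Context (K : fieldType) (G : choiceType).
Implicit Types (x y z : {freeg G / K}) (g h k : G).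

Lemma fglift_linear (V : lmodType K) (f : G -> V) : linear (fglift f).
Proof.
have addf : {morph fglift f : x y / x + y}.
  move=> x y; have B := lift_is_additive f.
  have N z : fglift f (- z) = - fglift f z.
    by rewrite -sub0r B -{1}(subrr z) B subrr sub0r.
  by rewrite -{1}(opprK y) B N opprK.
have f0 : fglift f 0 = 0.
  by have := lift_is_additive f 0 0; rewrite !subr0 subrr.
have liftS (I : Type) (r : seq I) (F : I -> {freeg G / K}) :
    fglift f (\sum_(i <- r) F i) = \sum_(i <- r) fglift f (F i).
  by elim/big_rec2: _ => [|i u v _ <-]; [exact: f0 | rewrite addf].
have fE x : fglift f x = \sum_(g <- dom x) coeff g x *: f g.
  by rewrite -{1}(freeg_sumE x) liftS; apply: eq_bigr => g _; rewrite liftU.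
move=> c x y; rewrite addf; congr (_ + _); rewrite /= [in RHS]fE scaler_sumr.
rewrite {1}/GRing.scale /= /fgscale liftS.
by apply: eq_bigr => g _; rewrite liftU scalerA.
Qed.

Lemma fglift1 (V : lmodType K) (f : G -> V) g : fglift f << g >> = f g.
Proof. by rewrite liftU scale1r. Qed.

Lemma freeg_lin_ind (P : {freeg G / K} -> Prop) :
    P 0 -> (forall c x y, P x -> P y -> P (c *: x + y)) ->
  (forall g, P << g >>) -> forall x, P x.
Proof.
move=> P0 PD P1 x; rewrite -(freeg_sumE x).
elim/big_rec: _ => // g u _ Pu.
suff -> : << coeff g x *g g >> = coeff g x *: << g >> :> {freeg G / K} by exact: PD.
by apply/eqP/freeg_eqP => h; rewrite coeffZ !coeffU mul1r.
Qed.

Context (br : G -> G -> {freeg G / K}).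

(* The bilinear extension of br. *)
Definition brext x y : {freeg G / K} := fglift (fun g => fglift (br g) y) x.

Lemma brextE g h : brext << g >> << h >> = br g h.
Proof. by rewrite /brext !fglift1. Qed.

Lemma brext_linearl y : linear (fun x => brext x y).
Proof. exact: fglift_linear. Qed.

Lemma brext_linearr x : linear (brext x).
Proof.
move=> c y z; rewrite /brext; elim/freeg_lin_ind: x => [|d x x' Ex Ex'|g].
- have f0 (f : G -> {freeg G / K}) : fglift f 0 = 0.
    by have := fglift_linear f (-1) 0 0; rewrite !scaleN1r !addNr.
  by rewrite !f0 scaler0 addr0.
- by rewrite !fglift_linear Ex Ex' !scalerDr !scalerA [c * d]mulrC addrACA.
- by rewrite !fglift1 fglift_linear.
Qed.

Lemma brextDl x y z : brext (x + y) z = brext x z + brext y z.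
Proof. by have := brext_linearl z 1 x y; rewrite !scale1r. Qed.

Lemma brextDr x y z : brext x (y + z) = brext x y + brext x z.
Proof. by have := brext_linearr x 1 y z; rewrite !scale1r. Qed.

Lemma brext0l y : brext 0 y = 0.
Proof. by apply: (addrI (brext 0 y)); rewrite -brextDl !addr0. Qed.

Lemma brext0r x : brext x 0 = 0.
Proof. by apply: (addrI (brext x 0)); rewrite -brextDr !addr0. Qed.

Lemma brextZl c x y : brext (c *: x) y = c *: brext x y.
Proof. by have := brext_linearl y c x 0; rewrite brext0l !addr0. Qed.

Lemma brextZr c x y : brext x (c *: y) = c *: brext x y.
Proof. by have := brext_linearr x c y 0; rewrite brext0r !addr0. Qed.

Hypothesis brxx : forall g, br g g = 0.
Hypothesis brC : forall g h, br g h = - br h g.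

Lemma brextC x y : brext x y = - brext y x.
Proof.
elim/freeg_lin_ind: x => [|c x x' Ex Ex'|g].
- by rewrite brext0l brext0r oppr0.
- by rewrite brext_linearl brext_linearr Ex Ex' scalerN -opprD.
elim/freeg_lin_ind: y => [|c y y' Ey Ey'|h].
- by rewrite brext0l brext0r oppr0.
- by rewrite brext_linearl brext_linearr Ey Ey' scalerN -opprD.
by rewrite !brextE brC.
Qed.

Lemma brextxx x : brext x x = 0.
Proof.
elim/freeg_lin_ind: x => [|c x x' Ex Ex'|g]; first exact: brext0l.
  rewrite brextDl !brextDr !brextZl !brextZr Ex Ex' !scaler0 add0r addr0.
  by rewrite [brext x' x]brextC scalerN subrr.
by rewrite brextE.
Qed.

Hypothesis br_jacobi : forall g h k,
  brext << g >> (br h k) + brext << h >> (br k g) + brext << k >> (br g h) = 0.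

Lemma brext_jacobi x y z :
  brext x (brext y z) + brext y (brext z x) + brext z (brext x y) = 0.
Proof.
have lin3 c (a a' b b' d d' : {freeg G / K}) : a + b + d = 0 ->
    a' + b' + d' = 0 -> (c *: a + a') + (c *: b + b') + (c *: d + d') = 0.
  move=> E E'; rewrite [_ + (c *: b + b')]addrACA [_ + (c *: d + d')]addrACA.
  by rewrite -!scalerDr E E' scaler0 addr0.
elim/freeg_lin_ind: x => [|c x x' Ex Ex'|g].
- by rewrite !(brext0l, brext0r) !addr0.
- by rewrite !(brext_linearl, brext_linearr); apply: lin3.
elim/freeg_lin_ind: y => [|c y y' Ey Ey'|h].
- by rewrite !(brext0l, brext0r) !addr0.
- by rewrite !(brext_linearl, brext_linearr); apply: lin3.
elim/freeg_lin_ind: z => [|c z z' Ez Ez'|k].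
- by rewrite !(brext0l, brext0r) !addr0.
- by rewrite !(brext_linearl, brext_linearr); apply: lin3.
by rewrite !brextE.
Qed.

End Extension.

Section ModuleExtension.
Context (K : fieldType) (G : choiceType) (V : lmodType K) (a : G -> V -> V).
Implicit Types (x : {freeg G / K}) (v : V).

(* The extension of a to the free module, linear in x. *)
Definition actext x v : V := fglift (fun g => a g v) x.

Lemma actextE g v : actext << g >> v = a g v.
Proof. exact: fglift1. Qed.

Lemma actext_linearl v : linear (fun x => actext x v).
Proof. exact: fglift_linear. Qed.

Lemma actextZl c x v : actext (c *: x) v = c *: actext x v.
Proof.
have l0 : actext 0 v = 0.
  by have := actext_linearl v (-1) 0 0; rewrite !scaleN1r !addNr.
by have := actext_linearl v c x 0; rewrite l0 !addr0.
Qed.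

Lemma actextNl x v : actext (- x) v = - actext x v.
Proof. by rewrite -[- x]scaleN1r actextZl scaleN1r. Qed.

Lemma actext0l v : actext 0 v = 0.
Proof. by have := actextZl 0 0 v; rewrite !scale0r. Qed.

Hypothesis a_linear : forall g, linear (a g).

Lemma actext_linearr x : linear (actext x).
Proof.
move=> c u v; elim/freeg_lin_ind: x => [|d x x' Ex Ex'|g].
- by rewrite !actext0l scaler0 addr0.
- by rewrite !actext_linearl Ex Ex' !scalerDr !scalerA [c * d]mulrC addrACA.
- by rewrite !actextE a_linear.
Qed.

Context (br : G -> G -> {freeg G / K}).
Hypothesis a_br : forall g h v,
  actext (br g h) v = a g (a h v) - a h (a g v).

Lemma actext_br x y v :
  actext (brext br x y) v = actext x (actext y v) - actext y (actext x v).
Proof.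
have r0 x' : actext x' 0 = 0.
  by have := actext_linearr x' (-1) 0 0; rewrite !scaleN1r !addNr.
have lin2 c (s s' t t' : V) :
    c *: (s - t) + (s' - t') = (c *: s + s') - (c *: t + t').
  by rewrite scalerBr opprD addrACA.
elim/freeg_lin_ind: x => [|c x x' Ex Ex'|g].
- by rewrite brext0l !actext0l r0 subrr.
- by rewrite brext_linearl !actext_linearl actext_linearr Ex Ex' lin2.
elim/freeg_lin_ind: y => [|c y y' Ey Ey'|h].
- by rewrite brext0r !actext0l r0 subrr.
- by rewrite brext_linearr !actext_linearl actext_linearr Ey Ey' lin2.
by rewrite brextE !actextE a_br.
Qed.

End ModuleExtension.

Inductive hvGen : Type := hvT of int * int | hvE of int * int.

Definition hvGen_code (g : hvGen) : (int * int) + (int * int) :=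
  match g with hvT m => inl m | hvE m => inr m end.
Definition hvGen_decode (s : (int * int) + (int * int)) : hvGen :=
  match s with inl m => hvT m | inr m => hvE m end.
Fact hvGen_codeK : cancel hvGen_code hvGen_decode.
Proof. by case. Qed.
HB.instance Definition _ := Choice.copy hvGen (can_type hvGen_codeK).

(* hvL embeds the basis t^m, E(m) of L(p1, p2); hvD 0 and hvD 1 are the degree
   derivations \partial_1 and \partial_2. *)
Inductive hvtGen : Type := hvL of hvGen | hvD of 'I_2.

Definition hvtGen_code (g : hvtGen) : hvGen + 'I_2 :=
  match g with hvL g => inl g | hvD i => inr i end.
Definition hvtGen_decode (s : hvGen + 'I_2) : hvtGen :=
  match s with inl g => hvL g | inr i => hvD i end.
Fact hvtGen_codeK : cancel hvtGen_code hvtGen_decode.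
Proof. by case. Qed.
HB.instance Definition _ := Choice.copy hvtGen (can_type hvtGen_codeK).

Section HeisenbergVirasoro.
Context (K : fieldType) (p1 p2 : K).

Definition hvdet (m n : int * int) : K :=
  (m.1%:~R + p1) * (n.2%:~R + p2) - (m.2%:~R + p2) * (n.1%:~R + p1).

(* [E(n), t^m] is obtained from [t^m, E(n)] by antisymmetry. *)
Definition hvbr (g h : hvGen) : {freeg hvGen / K} :=
  match g, h with
  | hvT m, hvT n => 0
  | hvT m, hvE n => - hvdet m n *: << hvT (m + n) >>
  | hvE n, hvT m => hvdet m n *: << hvT (m + n) >>
  | hvE m, hvE n => - hvdet m n *: << hvE (m + n) >>
  end.

Definition hvweight (i : 'I_2) (g : hvGen) : K :=
  match g with
  | hvT m => if i == 0 then m.1%:~R + p1 else m.2%:~R + p2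
  | hvE m => if i == 0 then m.1%:~R else m.2%:~R
  end.

Definition hvincl (x : {freeg hvGen / K}) : {freeg hvtGen / K} :=
  fglift (fun g => << hvL g >>) x.

Definition hvtbr (g h : hvtGen) : {freeg hvtGen / K} :=
  match g, h with
  | hvL g, hvL h => hvincl (hvbr g h)
  | hvD i, hvL g => hvweight i g *: << hvL g >>
  | hvL g, hvD i => - hvweight i g *: << hvL g >>
  | hvD _, hvD _ => 0
  end.

Lemma hvdetC m n : hvdet m n = - hvdet n m.
Proof. by rewrite /hvdet; ring. Qed.

Lemma hvdetxx m : hvdet m m = 0.
Proof. by rewrite /hvdet; ring. Qed.

Lemma hvbrxx g : hvbr g g = 0.
Proof. by case: g => m //=; rewrite hvdetxx oppr0 scale0r. Qed.

Lemma hvbrC g h : hvbr g h = - hvbr h g.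
Proof.
case: g h => [] m [] n /=; rewrite ?oppr0 -?scaleNr ?opprK //.
by rewrite hvdetC opprK addrC.
Qed.

Lemma hvbr_jacobi g h k :
  brext hvbr << g >> (hvbr h k) + brext hvbr << h >> (hvbr k g)
    + brext hvbr << k >> (hvbr g h) = 0.
Proof.
have scal3 (a b c : K) (u v w : {freeg hvGen / K}) :
    v = u -> w = u -> a + b + c = 0 -> a *: u + b *: v + c *: w = 0.
  by move=> -> -> E; rewrite -!scalerDl E scale0r.
case: g h k => [] m [] n [] k /=;
  rewrite ?brext0r ?brextZr ?brextE /= ?scaler0 ?addr0 ?add0r // ?scalerA;
  apply: scal3; rewrite /hvdet /= ?rmorphD /=; try ring;
  by congr (<< _ >>); congr (_ _); apply: injective_projections => /=; ring.
Qed.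

Lemma hvincl_linear : linear hvincl.
Proof. exact: fglift_linear. Qed.

Lemma hvincl1 g : hvincl << g >> = << hvL g >>.
Proof. exact: fglift1. Qed.

Lemma hvincl0 : hvincl 0 = 0.
Proof. by have := hvincl_linear (-1) 0 0; rewrite !scaleN1r !addNr. Qed.

Lemma hvinclZ c x : hvincl (c *: x) = c *: hvincl x.
Proof. by have := hvincl_linear c x 0; rewrite hvincl0 !addr0. Qed.

Lemma hvinclN x : hvincl (- x) = - hvincl x.
Proof. by rewrite -[- x]scaleN1r hvinclZ scaleN1r. Qed.

Lemma hvinclD x y : hvincl (x + y) = hvincl x + hvincl y.
Proof. by have := hvincl_linear 1 x y; rewrite !scale1r. Qed.

Lemma hvincl_brext x y :
  hvincl (brext hvbr x y) = brext hvtbr (hvincl x) (hvincl y).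
Proof.
elim/freeg_lin_ind: x => [|c x x' Ex Ex'|g].
- by rewrite hvincl0 !brext0l hvincl0.
- by rewrite brext_linearl !hvincl_linear brext_linearl Ex Ex'.
elim/freeg_lin_ind: y => [|c y y' Ey Ey'|h].
- by rewrite hvincl0 !brext0r hvincl0.
- by rewrite brext_linearr !hvincl_linear brext_linearr Ey Ey'.
by rewrite !hvincl1 !brextE.
Qed.

Lemma hvtbrxx g : hvtbr g g = 0.
Proof. by case: g => // g /=; rewrite hvbrxx hvincl0. Qed.

Lemma hvtbrC g h : hvtbr g h = - hvtbr h g.
Proof.
by case: g h => [g|i] [h|j] /=; rewrite ?oppr0 -?scaleNr ?opprK // hvbrC hvinclN.
Qed.

Lemma hvweight_br i g h :
  brext hvtbr << hvD i >> (hvincl (hvbr g h)) =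
    (hvweight i g + hvweight i h) *: hvincl (hvbr g h).
Proof.
case: g h => [] m [] n /=;
  rewrite ?hvincl0 ?brext0r ?scaler0 // hvinclZ hvincl1 brextZr brextE /=;
  rewrite !scalerA mulrC; congr (_ * _ *: _);
  by case: ifP => _ /=; rewrite rmorphD /=; ring.
Qed.

Lemma hvtbr_jacobi g h k :
  brext hvtbr << g >> (hvtbr h k) + brext hvtbr << h >> (hvtbr k g)
    + brext hvtbr << k >> (hvtbr g h) = 0.
Proof.
have DLL i (g' h' : hvGen) :
    brext hvtbr << hvD i >> (hvincl (hvbr g' h'))
      + brext hvtbr << hvL g' >> (- hvweight i h' *: << hvL h' >>)
      + brext hvtbr << hvL h' >> (hvweight i g' *: << hvL g' >>) = 0.
  rewrite hvweight_br !brextZr !brextE /= (hvbrC h' g') hvinclN.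
  by rewrite scalerN -scaleNr -!scalerDl addrK subrr scale0r.
have DDL i j (g' : hvGen) :
    brext hvtbr << hvD i >> (hvweight j g' *: << hvL g' >>)
      + brext hvtbr << hvD j >> (- hvweight i g' *: << hvL g' >>) = 0.
  rewrite !brextZr !brextE /= !scalerA -scalerDl.
  by rewrite mulNr mulrC subrr scale0r.
case: g h k => [g|i] [h|j] [k|l] /=; rewrite ?brext0r ?addr0 ?add0r //.
- by rewrite -!hvincl1 -!hvincl_brext -!hvinclD hvbr_jacobi hvincl0.
- by rewrite addrC addrA DLL.
- by rewrite -addrA addrC DLL.
- by rewrite addrC DDL.
Qed.

End HeisenbergVirasoro.

(* The carriers do not depend on p1 and p2: these parameters are there to select
   the bracket. *)
Definition heisVir (K : fieldType) (p1 p2 : K) : Type := {freeg hvGen / K}.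
HB.instance Definition _ (K : fieldType) (p1 p2 : K) :=
  GRing.Lmodule.on (heisVir p1 p2).
HB.instance Definition _ (K : fieldType) (p1 p2 : K) :=
  isLieAlgebra.Build K (heisVir p1 p2)
    (@brext_linearl K hvGen (hvbr p1 p2)) (@brext_linearr K hvGen (hvbr p1 p2))
    (brextxx (hvbrxx p1 p2) (hvbrC p1 p2)) (brext_jacobi (hvbr_jacobi p1 p2)).

Definition heisVirt (K : fieldType) (p1 p2 : K) : Type := {freeg hvtGen / K}.
HB.instance Definition _ (K : fieldType) (p1 p2 : K) :=
  GRing.Lmodule.on (heisVirt p1 p2).
HB.instance Definition _ (K : fieldType) (p1 p2 : K) :=
  isLieAlgebra.Build K (heisVirt p1 p2)
    (@brext_linearl K hvtGen (hvtbr p1 p2)) (@brext_linearr K hvtGen (hvtbr p1 p2))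
    (brextxx (hvtbrxx p1 p2) (hvtbrC p1 p2)) (brext_jacobi (hvtbr_jacobi p1 p2)).

Definition heisVir_incl (K : fieldType) (p1 p2 : K) :
    lieHom (heisVir p1 p2) (heisVirt p1 p2) :=
  @LieHom K (heisVir p1 p2) (heisVirt p1 p2) (@hvincl K) (@hvincl_linear K)
    (hvincl_brext p1 p2).

Section Omega.
Context (K : fieldType) (p1 p2 lam1 lam2 alpha b0 : K).
Implicit Types (f : {mpoly K[2]}) (m n : int * int).

(* f(\partial_1 - a1, \partial_2 - a2) *)
Definition shift (a1 a2 : K) f : {mpoly K[2]} :=
  f \mPo [tuple 'X_0 - a1%:MP; 'X_1 - a2%:MP].

Definition lampow m : K := lam1 ^ m.1 * lam2 ^ m.2.

(* 'X_0 and 'X_1 stand for \partial_1 and \partial_2. *)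
Definition omega_gen (g : hvtGen) f : {mpoly K[2]} :=
  match g with
  | hvL (hvT m) => (lampow m * b0) *: shift (m.1%:~R + p1) (m.2%:~R + p2) f
  | hvL (hvE m) =>
      lampow m *:
        (((m.2%:~R + p2) *: ('X_0 + (p1 * alpha)%:MP)
          - (m.1%:~R + p1) *: ('X_1 + (p2 * alpha)%:MP))
         * shift m.1%:~R m.2%:~R f)
  | hvD i => 'X_i * f
  end.

Lemma shift_linear a1 a2 : linear (shift a1 a2).
Proof. by move=> c f g; rewrite /shift comp_mpolyD comp_mpolyZ. Qed.

Lemma shiftM a1 a2 f g : shift a1 a2 (f * g) = shift a1 a2 f * shift a1 a2 g.
Proof. exact: rmorphM. Qed.

Lemma shiftD a1 a2 f g : shift a1 a2 (f + g) = shift a1 a2 f + shift a1 a2 g.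
Proof. exact: comp_mpolyD. Qed.

Lemma shiftN a1 a2 f : shift a1 a2 (- f) = - shift a1 a2 f.
Proof. exact: comp_mpolyN. Qed.

Lemma shiftZ a1 a2 c f : shift a1 a2 (c *: f) = c *: shift a1 a2 f.
Proof. exact: comp_mpolyZ. Qed.

Lemma shift0 a1 a2 : shift a1 a2 0 = 0.
Proof. exact: comp_mpoly0. Qed.

Lemma shift1 a1 a2 : shift a1 a2 1 = 1.
Proof. exact: comp_mpoly1. Qed.

Lemma shiftC a1 a2 c : shift a1 a2 c%:MP = c%:MP.
Proof. exact: comp_mpolyC. Qed.

Lemma shiftX a1 a2 (i : 'I_2) :
  shift a1 a2 'X_i = 'X_i - (if i == 0 then a1 else a2)%:MP.
Proof.
rewrite /shift comp_mpolyXU.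
by case: i => [[|[|//]] lti] /=; congr ('X_ _ - _); apply: val_inj.
Qed.

Lemma shift_shift a1 a2 c1 c2 f :
  shift a1 a2 (shift c1 c2 f) = shift (a1 + c1) (a2 + c2) f.
Proof.
elim/mpolyind: f => [|c m f _ _ IHf]; first by rewrite !shift0.
rewrite !shiftD !shiftZ IHf; do 2!f_equal; rewrite mpolyXE_id.
rewrite !(big_morph _ (shiftM _ _) (shift1 _ _)); apply: eq_bigr => i _.
elim: (m i) => [|k IHk]; first by rewrite !expr0 !shift1.
rewrite !exprS !shiftM IHk !shiftX shiftD shiftN shiftX shiftC; congr (_ * _).
by case: ifP => _; rewrite mpolyCD; ring.
Qed.

Lemma omega_gen_linear g : linear (omega_gen g).
Proof.
case: g => [[m|m]|i] c f f' /=.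
- by rewrite shift_linear scalerDr !scalerA [c * _]mulrC.
- by rewrite shift_linear mulrDr -scalerAr scalerDr !scalerA [c * _]mulrC.
- by rewrite mulrDr scalerAr.
Qed.

Hypotheses (lam1_neq0 : lam1 != 0) (lam2_neq0 : lam2 != 0).

Lemma lampowD m n : lampow (m + n) = lampow m * lampow n.
Proof. by rewrite /lampow /= !expfzDr // mulrACA. Qed.

Lemma omega_gen_br g h f :
  actext omega_gen (hvtbr p1 p2 g h) f =
    omega_gen g (omega_gen h f) - omega_gen h (omega_gen g f).
Proof.
pose br_ok g h := actext omega_gen (hvtbr p1 p2 g h) f =
    omega_gen g (omega_gen h f) - omega_gen h (omega_gen g f).
have sym g' h' : br_ok g' h' -> br_ok h' g'.
  by rewrite /br_ok => E; rewrite hvtbrC actextNl E opprB.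
have shiftE a1 a2 c1 c2 : a1 = c1 -> a2 = c2 -> shift a1 a2 f = shift c1 c2 f.
  by move=> -> ->.
have TT m n : br_ok (hvL (hvT m)) (hvL (hvT n)).
  rewrite /br_ok /= hvincl0 actext0l !shiftZ !shift_shift !scalerA.
  rewrite [lampow n * b0 * _]mulrC -scalerBr.
  by rewrite (shiftE _ _ _ _ (addrC _ _) (addrC _ _)) subrr scaler0.
have TE m n : br_ok (hvL (hvT m)) (hvL (hvE n)).
  rewrite /br_ok /= hvinclZ hvincl1 actextZl actextE /= lampowD.
  rewrite !(shiftZ, shiftM, shiftD, shiftN, shiftX, shiftC, shift_shift) /=.
  set F := shift ((m + n).1%:~R + p1) _ f.
  have -> : shift (m.1%:~R + p1 + n.1%:~R) (m.2%:~R + p2 + n.2%:~R) f = F.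
    by apply: shiftE; rewrite /= rmorphD /=; ring.
  have -> : shift (n.1%:~R + (m.1%:~R + p1)) (n.2%:~R + (m.2%:~R + p2)) f = F.
    by apply: shiftE; rewrite /= rmorphD /=; ring.
  rewrite -!mul_mpolyC /hvdet !(mpolyCD, mpolyCN, mpolyCM); ring.
have EE m n : br_ok (hvL (hvE m)) (hvL (hvE n)).
  rewrite /br_ok /= hvinclZ hvincl1 actextZl actextE /= lampowD.
  rewrite !(shiftZ, shiftM, shiftD, shiftN, shiftX, shiftC, shift_shift) /=.
  set F := shift (m.1 + n.1)%:~R _ f.
  have -> : shift (m.1%:~R + n.1%:~R) (m.2%:~R + n.2%:~R) f = F.
    by apply: shiftE; rewrite /= rmorphD.
  have -> : shift (n.1%:~R + m.1%:~R) (n.2%:~R + m.2%:~R) f = F.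
    by apply: shiftE; rewrite /= rmorphD addrC.
  rewrite -!mul_mpolyC /hvdet !rmorphD /= !(mpolyCD, mpolyCN, mpolyCM); ring.
have DT i m : br_ok (hvD i) (hvL (hvT m)).
  rewrite /br_ok /= actextZl actextE /= shiftM shiftX.
  rewrite -!mul_mpolyC !mpolyCM; case: ifP => _; rewrite mpolyCD; ring.
have DE i m : br_ok (hvD i) (hvL (hvE m)).
  rewrite /br_ok /= actextZl actextE /= shiftM shiftX.
  rewrite -!mul_mpolyC; case: ifP => _; ring.
have DD i j : br_ok (hvD i) (hvD j).
  by rewrite /br_ok /= actext0l mulrCA subrr.
by case: g h => [[m|m]|i] [[n|n]|j]; rewrite -/(br_ok _ _) //; exact: sym.
Qed.

Definition omega : lieModule (heisVirt p1 p2) :=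
  @LieModule K (heisVirt p1 p2) {mpoly K[2]} (actext omega_gen)
    (actext_linearl omega_gen) (actext_linearr omega_gen_linear)
    (actext_br omega_gen_linear omega_gen_br).

End Omega.

(* Main.v *)
Require Import Defs.
From HB Require Import structures.
From mathcomp Require Import all_boot all_order all_algebra.
From mathcomp Require Import reals complex.
From mathcomp Require Import mpoly freeg.
From mathcomp Require Import ring zify.
From mathcomp Require boolp.

Set Implicit Arguments.
Unset Strict Implicit.
Unset Printing Implicit Defensive.

Import GRing.Theory.
Local Open Scope ring_scope.

(** Let S be a nonzero subspace of K[X_0, X_1] that is stable under all the
t^m and E(m). Up to nonzero scalars, t^m is the translation by m + p and E(m)
is a translation by m followed by multiplication by the linear form
(m_2 + p_2)(X_0 + p_1 alpha) - (m_1 + p_1)(X_1 + p_2 alpha).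

S contains 1 ([stable_subspace_has1]). Let f in S be nonzero, of degree d > 0.
The difference of t^m f and t^0 f, suitably rescaled, is the translate by p of
f(X - m) - f, a polynomial of degree less than d. In characteristic 0 a
nonconstant polynomial cannot be periodic in both directions e_1 and e_2, so
m = e_1 or m = e_2 yields a nonzero element of S of smaller degree, and one
concludes by induction. That f is not periodic is read off its first-order
Taylor expansion: modulo polynomials of degree at most d - 2, f(X - e_i) - f is
minus the i-th partial derivative of f ([msize_taylor_rem]), and this derivative
has degree exactly d - 1 when X_i divides the leading monomial of f.

S then contains everything. Since p need not be integral, it is not clear that
S itself is stable under translations by integer vectors, so consider the set W
of those f all of whose integer translates lie in S. For g in W, applying E(m)
to the translate of g by -m puts the linear form times g in S, for every m; the
linear form is affine in m, so its differences between m = 0, e_1, e_2 give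
X_0 g and X_1 g in S. Hence W is stable under multiplication by the variables
([stable_subspace_mulX]); it contains 1, so W and S are the whole space.

Simplicity over the larger algebra follows, as it has fewer stable
subspaces. *)

(** * Degree bounds for linear operators on polynomials *)

Section MonomialBounds.
Context (n : nat) (K : idomainType).
Implicit Types (m : 'X_{1..n}) (f : {mpoly K[n]}).

Lemma mnm_ind (P : 'X_{1..n} -> Prop) :
  P 0%MM -> (forall i m, P m -> P (U_(i) + m)%MM) -> forall m, P m.
Proof.
move=> P0 PS m; have [d] := ubnP (mdeg m).
elim: d m => // d IHd m; rewrite ltnS => le_md.
have [->//|m_neq0] := eqVneq m 0%MM.
have [i mi_gt0] : exists i, (0 < m i)%N.
  apply/existsP; apply: contraNT m_neq0 => /existsPn m0.
  by apply/eqP/mnmP => i; rewrite mnm0E; apply/eqP; rewrite -leqn0 leqNgt m0.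
have mE : (U_(i) + (m - U_(i)) = m)%MM.
  rewrite addmC submK //; apply/mnm_lepP => j; rewrite mnm1E.
  by case: eqP => // <-.
rewrite -mE; apply/PS/IHd; apply: leq_trans le_md.
by rewrite -[in ltnRHS]mE mdegD mdeg1.
Qed.

(** The case distinction matters to [msize_taylor_rem], where the crude bound
(msize f).+1 would be off by one when f = 0. *)
Lemma msize_mulX i f : (msize ('X_i * f) <= if f == 0%R then 0 else (msize f).+1)%N.
Proof.
have [->|f_neq0] := eqVneq f 0; first by rewrite mulr0 msize0.
by rewrite msizeM -?msize_poly_eq0 ?msizeX ?mdeg1 ?msize_poly_eq0.
Qed.

Lemma msize_lin_le (T : {mpoly K[n]} -> {mpoly K[n]}) k :
    linear T -> (forall m, msize (T 'X_[m]) <= mdeg m - k)%N ->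
  forall f, (msize (T f) <= (msize f).-1 - k)%N.
Proof.
move=> linT leT f.
have T0 : T 0 = 0 by have := linT (-1) 0 0; rewrite !scaleN1r !addNr.
rewrite [in T f](mpolyE f) big_seq.
elim/big_rec: _ => [|m g m_f IHg]; first by rewrite T0 msize0.
rewrite linT; apply: leq_trans (msizeD_le _ _) _; rewrite geq_max IHg andbT.
apply: leq_trans (msizeZ_le _ _) (leq_trans (leT m) (leq_sub2r _ _)).
by have := msize_mdeg_lt m_f; case: (msize f).
Qed.

End MonomialBounds.

(** * Taylor expansion of a translation *)

Section ShiftDegree.
Context (K : fieldType) (a1 a2 : K).
Implicit Types (f : {mpoly K[2]}).

(** The remainder of the first-order Taylor expansion of f(X - a) at X. *)
Definition taylor_rem f : {mpoly K[2]} :=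
  shift a1 a2 f - f + a1 *: mderiv 0 f + a2 *: mderiv 1 f.

Lemma shift_sub_linear : linear (fun f => shift a1 a2 f - f).
Proof. by move=> c f g; rewrite shift_linear scalerBr opprD addrACA. Qed.

Lemma taylor_rem_linear : linear taylor_rem.
Proof.
move=> c f g; rewrite /taylor_rem shift_linear !mderivD !mderivZ -!mul_mpolyC; ring.
Qed.

(** This and [taylor_rem_mulX] are the recursions over monomials from which the
two degree bounds below are obtained. *)
Lemma shift_sub_mulX i f :
  shift a1 a2 ('X_i * f) - 'X_i * f =
    'X_i * (shift a1 a2 f - f) - (if i == 0 then a1 else a2) *: shift a1 a2 f.
Proof. rewrite shiftM shiftX -mul_mpolyC; ring. Qed.

Lemma taylor_rem_mulX i f :
  taylor_rem ('X_i * f) =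
    'X_i * taylor_rem f - (if i == 0 then a1 else a2) *: (shift a1 a2 f - f).
Proof.
have dX (j k : 'I_2) : mderiv j 'X_k = (j == k)%:R :> {mpoly K[2]}.
  rewrite mderivX mnm1E eq_sym; case: eqP => [->|_]; last by rewrite scale0r.
  rewrite scale1r -mpolyX0; congr 'X_[_]; apply/mnmP => l.
  by rewrite mnmBE mnm0E subnn.
rewrite /taylor_rem shift_sub_mulX !mderivM !dX -!mul_mpolyC.
by case: i => [[|[|//]] lti]; rewrite -!val_eqE /=; ring.
Qed.

Lemma msize_shift_subX m :
  (msize (shift a1 a2 'X_[m] - 'X_[m]) <= mdeg m)%N.
Proof.
elim/mnm_ind: m => [|i m IHm]; first by rewrite mpolyX0 shift1 subrr msize0.
rewrite mpolyXD shift_sub_mulX mdegD mdeg1.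
apply: leq_trans (msizeD_le _ _) _; rewrite geq_max msizeN; apply/andP; split.
  by apply: leq_trans (msize_mulX _ _) _; case: ifP.
apply: leq_trans (msizeZ_le _ _) _; rewrite -[shift _ _ _](subrK 'X_[m]).
by apply: leq_trans (msizeD_le _ _) _; rewrite geq_max msizeX leqnn (leqW IHm).
Qed.

Lemma msize_shift_sub f : (msize (shift a1 a2 f - f) <= (msize f).-1)%N.
Proof.
rewrite -[leqRHS]subn0; apply: (msize_lin_le shift_sub_linear) => m.
by rewrite subn0 msize_shift_subX.
Qed.

Lemma msize_taylor_rem f : (msize (taylor_rem f) <= (msize f).-2)%N.
Proof.
rewrite -[leqRHS]subn1; apply: (msize_lin_le taylor_rem_linear) => {f} m.
elim/mnm_ind: m => [|i m IHm].
  by rewrite /taylor_rem mpolyX0 shift1 -mpolyC1 !mderivC !scaler0 subrr !addr0 msize0.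
rewrite mpolyXD taylor_rem_mulX mdegD mdeg1.
apply: leq_trans (msizeD_le _ _) _; rewrite geq_max msizeN; apply/andP; split.
  apply: leq_trans (msize_mulX _ _) _; case: eqP => // /eqP.
  by rewrite -msize_poly_eq0; lia.
by apply: leq_trans (msizeZ_le _ _) _; rewrite addnC addnK msize_shift_subX.
Qed.

End ShiftDegree.

(** * Nonconstant polynomials are not periodic *)

Section ShiftInvariant.
Context (K : fieldType) (K0 : [pchar K] =i pred0).
Implicit Types (f : {mpoly K[2]}).

Lemma shift_id f : shift 0 0 f = f.
Proof.
elim/mpolyind: f => [|c m f _ _ IHf]; first exact: shift0.
rewrite shiftD shiftZ IHf; congr (_ *: _ + _).
elim/mnm_ind: m => [|i m IHm]; first by rewrite mpolyX0 shift1.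
by rewrite mpolyXD shiftM IHm shiftX if_same mpolyC0 subr0.
Qed.

Lemma shift_inj a1 a2 : injective (@shift K a1 a2).
Proof.
apply: (can_inj (g := shift (- a1) (- a2))) => f.
by rewrite shift_shift !addNr shift_id.
Qed.

Lemma msize_mderiv_mlead i f :
  (0 < mlead f i)%N -> ((msize f).-1 <= msize (mderiv i f))%N.
Proof.
move=> mi_gt0; have f_neq0 : f != 0.
  by apply: contraTneq mi_gt0 => ->; rewrite mlead0 mnm0E.
have mE : (mlead f - U_(i) + U_(i) = mlead f)%MM.
  by rewrite submK //; apply/mnm_lepP => j; rewrite mnm1E; case: eqP => // <-.
rewrite -mlead_deg //= -[in leqLHS]mE mdegD mdeg1 addn1 msize_mdeg_lt //.
rewrite mcoeff_msupp mcoeff_mderiv mE -mulr_natr mulf_neq0 ?mleadc_eq0 //.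
by have /pcharf0P -> := K0.
Qed.

(** If f were fixed by both translations, its Taylor remainders would be its
partial derivatives, whose degree would then drop by at least two. *)
Lemma nonconst_not_periodic f : (1 < msize f)%N ->
  shift 1 0 f != f \/ shift 0 1 f != f.
Proof.
move=> f_gt1; have f_neq0 : f != 0 by apply: contraTneq f_gt1 => ->; rewrite msize0.
have: mlead f != 0%MM.
  by rewrite -mdeg_eq0; have := mlead_deg f_neq0; case: mdeg => // E; rewrite -E in f_gt1.
have gap k : (k <= (msize f).-2)%N -> ((msize f).-1 <= k)%N -> False by lia.
case: (posnP (mlead f 0)) => [m0|m0 _].
  case: (posnP (mlead f 1)) => [m1|m1 _].
    case/eqP; apply/mnmP => -[[|[|//]] lti]; rewrite mnm0E.
      by rewrite (_ : Ordinal lti = 0) //; apply: val_inj.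
    by rewrite (_ : Ordinal lti = 1) //; apply: val_inj.
  right; apply/eqP => fE; have := msize_mderiv_mlead m1.
  have := msize_taylor_rem 0 1 f.
  by rewrite /taylor_rem fE subrr scale0r scale1r !add0r => /gap.
left; apply/eqP => fE; have := msize_mderiv_mlead m0.
have := msize_taylor_rem 1 0 f.
by rewrite /taylor_rem fE subrr scale0r scale1r add0r addr0 => /gap.
Qed.

End ShiftInvariant.

(** * Subspaces stable under the Heisenberg-Virasoro operators *)

Section StableSubspace.
Context (K : fieldType) (K0 : [pchar K] =i pred0) (p1 p2 alpha : K).
Context (S : {mpoly K[2]} -> Prop).
Implicit Types (f : {mpoly K[2]}) (m : int * int).
(* [ST] and [SE] are stability under t^m and E(m), with the nonzero scalar factors
   of these operators removed. *)
Hypotheses (S0 : S 0) (SDZ : forall c f g, S f -> S g -> S (c *: f + g)).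
Hypothesis ST : forall m f, S f -> S (shift (m.1%:~R + p1) (m.2%:~R + p2) f).
Hypothesis SE : forall m f, S f ->
  S (((m.2%:~R + p2) *: ('X_0 + (p1 * alpha)%:MP)
      - (m.1%:~R + p1) *: ('X_1 + (p2 * alpha)%:MP)) * shift m.1%:~R m.2%:~R f).

Let SZ c f : S f -> S (c *: f).
Proof. by move=> Sf; rewrite -[_ *: _]addr0; apply: SDZ. Qed.

Let SB f g : S f -> S g -> S (f - g).
Proof. by move=> Sf Sg; rewrite addrC -scaleN1r; apply: SDZ. Qed.

(** Descent on the degree: t^(e_i) - t^0 lowers it, and for a nonconstant f one
of the two differences is nonzero. *)
Lemma stable_subspace_has1 f : S f -> f != 0 -> S 1.
Proof.
have [d] := ubnP (msize f).
elim: d f => // d IHd f; rewrite ltnS => le_fd Sf f_neq0.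
have [f_le1|f_gt1] := leqP (msize f) 1.
  have fE := msize1_polyC f_le1; have c_neq0 : f@_0 != 0.
    by apply: contraNneq f_neq0 => E; rewrite fE E mpolyC0.
  suff -> : 1 = (f@_0)^-1 *: f by exact: SZ.
  by rewrite {2}fE -mul_mpolyC -mpolyCM mulVf // mpolyC1.
have diffS (m : int * int) : shift m.1%:~R m.2%:~R f != f -> S 1.
  move=> df_neq0; have df_lt := msize_shift_sub m.1%:~R m.2%:~R f.
  have shE c : shift p1 p2 (shift c.1%:~R c.2%:~R f) =
      shift (c.1%:~R + p1) (c.2%:~R + p2) f.
    by rewrite shift_shift addrC [p2 + _]addrC.
  (* Only translations by m + p are available, so the difference is obtained
     translated by p; this changes neither its degree bound nor its nonvanishing. *)
  apply: (IHd (shift p1 p2 (shift m.1%:~R m.2%:~R f - f))).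
  - set g := _ - f in df_lt *.
    have lt_gd : (msize g < d)%N.
      by apply: leq_ltn_trans df_lt _; case: (msize f) f_gt1 le_fd.
    rewrite -[shift _ _ _](subrK g); apply: leq_ltn_trans (msizeD_le _ _) _.
    rewrite gtn_max lt_gd andbT; apply: leq_ltn_trans (msize_shift_sub _ _ _) _.
    exact: leq_ltn_trans (leq_pred _) lt_gd.
  - rewrite shiftD shiftN shE; apply: SB; first exact: ST.
    by have := ST (0, 0) Sf; rewrite /= !add0r.
  - by rewrite -(shift0 p1 p2) (inj_eq (@shift_inj K p1 p2)) subr_eq0.
have [] := nonconst_not_periodic K0 f_gt1; first exact: (diffS (1, 0)).
exact: (diffS (0, 1)).
Qed.

(** The set of polynomials all of whose integer translates lie in S, rather than
S, is what can be shown to be stable under multiplication by the variables: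
E(m) translates its argument by m, and this must be undone beforehand. *)
Lemma stable_subspace_mulX (i : 'I_2) f :
  (forall m, S (shift m.1%:~R m.2%:~R f)) ->
  forall m, S (shift m.1%:~R m.2%:~R ('X_i * f)).
Proof.
move=> Sf m; rewrite shiftM shiftX.
have Sg (k : int * int) : S (shift k.1%:~R k.2%:~R (shift m.1%:~R m.2%:~R f)).
  have := Sf (k + m); rewrite shift_shift /=.
  by rewrite !rmorphD.
have gE := Sg (0, 0); rewrite /= shift_id in gE.
set g := shift _ _ f in Sg gE *.
have SP k : S (((k.2%:~R + p2) *: ('X_0 + (p1 * alpha)%:MP)
      - (k.1%:~R + p1) *: ('X_1 + (p2 * alpha)%:MP)) * g).
  have := SE k (Sg (- k)); rewrite shift_shift /= !rmorphN /= !subrr.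
  by rewrite shift_id.
have SX (j : 'I_2) : S ('X_j * g).
  case: j => [[|[|//]] ltj].
    (* The linear form changes by X_0 + p_1 alpha between m = 0 and m = e_2,
       and by -(X_1 + p_2 alpha) between m = 0 and m = e_1. *)
    have := SDZ (- (p1 * alpha)) gE (SB (SP (0, 1)) (SP (0, 0))).
    congr S; rewrite -!mul_mpolyC !(mpolyCD, mpolyCN, mpolyCM) /=.
    rewrite (_ : 'X_(Ordinal ltj) = 'X_0); last by congr 'X_ _; exact: val_inj.
    ring.
  have := SDZ (- (p2 * alpha)) gE (SB (SP (0, 0)) (SP (1, 0))).
  congr S; rewrite -!mul_mpolyC !(mpolyCD, mpolyCN, mpolyCM) /=.
  rewrite (_ : 'X_(Ordinal ltj) = 'X_1); last by congr 'X_ _; exact: val_inj.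
  ring.
by rewrite mulrBl mul_mpolyC; apply: SB (SX i) (SZ _ gE).
Qed.

Lemma stable_subspace_full f : S f -> f != 0 -> forall g, S g.
Proof.
move=> Sf f_neq0; have S1 := stable_subspace_has1 Sf f_neq0.
elim/mpolyind => // c k g _ _; apply: SDZ; rewrite -['X_[k]]shift_id.
suff: forall m, S (shift m.1%:~R m.2%:~R 'X_[k]) by move/(_ (0, 0)).
elim/mnm_ind: k => [|i k IHk]; first by move=> m; rewrite mpolyX0 shift1.
by rewrite mpolyXD; apply: stable_subspace_mulX.
Qed.

End StableSubspace.

(** * Simplicity of the modules Omega *)

Section OmegaSimple.
Context (K : fieldType) (K0 : [pchar K] =i pred0).
Context (p1 p2 lam1 lam2 alpha b0 : K).
Hypotheses (lam1_neq0 : lam1 != 0) (lam2_neq0 : lam2 != 0) (b0_neq0 : b0 != 0).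

Lemma lieModule_res_simple (L L' : lieAlgType K) (phi : lieHom L L')
    (M : lieModule L') :
  simple_module (lieModule_res phi M) -> simple_module M.
Proof.
case=> nzM simM; split=> // S [S0 SDZ SL]; apply: simM.
by split=> // x v; exact: SL.
Qed.

Lemma omega_res_simple :
  simple_module
    (lieModule_res (heisVir_incl p1 p2) (omega p1 p2 alpha b0 lam1_neq0 lam2_neq0)).
Proof.
split; first by exists (1 : {mpoly K[2]}); apply/eqP; exact: oner_neq0.
move=> S [S0 SDZ SL].
have Sgen (g : hvGen) (v : {mpoly K[2]}) :
    S v -> S (omega_gen p1 p2 lam1 lam2 alpha b0 (hvL g) v).
  move=> Sv; have := SL (<< g >> : {freeg hvGen / K}) v Sv.
  by rewrite /= hvincl1 actextE.
have SZK c (v : {mpoly K[2]}) : c != 0 -> S (c *: v) -> S v.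
  move=> c_neq0 /(fun H => SDZ c^-1 _ _ H S0).
  by rewrite addr0 [_ *: (_ *: _)]scalerA mulVf // scale1r.
have lam_neq0 m : lampow lam1 lam2 m != 0 by rewrite mulf_neq0 ?expfz_neq0.
case: (boolp.pselect (exists2 v : {mpoly K[2]}, S v & v != 0)) => [[v Sv v_neq0]|noS].
  right; apply: (@stable_subspace_full K K0 p1 p2 alpha S S0 SDZ _ _ v) => //.
    move=> m f /(Sgen (hvT m)); apply: SZK.
    exact: mulf_neq0.
  by move=> m f /(Sgen (hvE m)); apply: SZK.
left=> v Sv; apply/eqP/negPn/negP => v_neq0.
by apply: noS; exists v.
Qed.

End OmegaSimple.

Theorem theorem2p5 (R : realType) (p1 p2 lam1 lam2 alpha b0 : R[i])
    (p1_neq0 : p1 != 0) (p2_neq0 : p2 != 0)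
    (lam1_neq0 : lam1 != 0) (lam2_neq0 : lam2 != 0) (b0_neq0 : b0 != 0) :
  simple_module
    (lieModule_res (heisVir_incl p1 p2) (omega p1 p2 alpha b0 lam1_neq0 lam2_neq0)) /\
  simple_module (omega p1 p2 alpha b0 lam1_neq0 lam2_neq0).
Proof.
have simL := omega_res_simple (Num.Theory.pchar_num R[i]) p1 p2 alpha
  lam1_neq0 lam2_neq0 b0_neq0.
by split; last exact: lieModule_res_simple simL.
Qed.
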